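(* Let $k \geq 2$ be an integer and let $R$ be a finite commutative local ring with $2^{nr}$ elements for some integers $n, r$ such that $R/J(R)$ is a field with $2^r$ elements. Then for any $c=x_1+x_2\mathbf{i}+x_3\mathbf{j}+x_4\mathbf{k} \in H(R)$ (with $x_1,x_2,x_3,x_4\in R$) we have $$\varphi_{k}(H(R), c)=\begin{cases} (-1)^k\,2^{(4nk-4n-k)r} \left(2^{r+k-1} -2^k + (2-2^{r})^k \right), & \text{if } x_1+x_2+x_3+x_4 \in \{0,1\} \bmod J(R), \\ (-1)^k\,2^{(4nk-4n-k)r} \left(-2^k + (2-2^{r})^k \right), & \text{otherwise}, \end{cases}$$ where ''$x_1+x_2+x_3+x_4 \in \{0,1\} \bmod J(R)$'' means that the class of $x_1+x_2+x_3+x_4$ in $R/J(R)$ is $0$ or $1$.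
   Context: All rings are associative with identity; $J(S)$ is the Jacobson radical of a ring $S$. For a ring $S$, $S^{*}$ denotes its group of units, and $u\in S$ is an exceptional unit if $u\in S^*$ and $1-u\in S^*$; $S^{**}$ is the set of exceptional units of $S$. For an integer $k\ge 2$ and $c\in S$, $\varphi_k(S,c)=|\{(y_1,\dots,y_k)\in (S^{**})^k : y_1+\dots+y_k=c\}|$. For a commutative ring $R$, the quaternion ring is $H(R)=R\oplus R\mathbf{i}\oplus R\mathbf{j}\oplus R\mathbf{k}$ with componentwise addition and multiplication determined by $\mathbf{i}^2=\mathbf{j}^2=\mathbf{k}^2=\mathbf{i}\mathbf{j}\mathbf{k}=-1$, $\mathbf{i}\mathbf{j}=-\mathbf{j}\mathbf{i}$, where $\mathbf{i},\mathbf{j},\mathbf{k}$ commute with the elements of $R$. *)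

(* Defs.v *)
From HB Require Import structures.
From mathcomp Require Import all_boot all_order all_algebra.
From mathcomp Require Import ring.

Set Implicit Arguments.
Unset Strict Implicit.
Unset Printing Implicit Defensive.

Import GRing.Theory.
Local Open Scope ring_scope.
Local Open Scope quotient_scope.

Section Jacobson.
Variable S : finNzRingType.
Implicit Types (I M : {set S}) (a u v : S).

Definition left_ideal I : bool :=
  [&& 0 \in I, [forall u in I, forall v in I, u + v \in I]
    & [forall a, forall u in I, a * u \in I]].

Definition proper_left_ideal I : bool := left_ideal I && (I != [set: S]).

Definition maximal_left_ideal M : bool := maxset proper_left_ideal M.

Definition jacobson : pred S :=
  [pred u | u \in \bigcap_(M : {set S} | maximal_left_ideal M) M].

Definition local_ring : bool := #|[set M | maximal_left_ideal M]| == 1%N.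

Lemma left_idealP I : reflect
  [/\ 0 \in I, {in I &, forall u v, u + v \in I}
    & forall a, {in I, forall u, a * u \in I}] (left_ideal I).
Proof.
apply: (iffP and3P) => [[I0 ID IM]|[I0 ID IM]]; split=> //.
- by move=> u v Iu Iv; move/forall_inP/(_ u Iu)/forall_inP/(_ v Iv): ID.
- by move=> a u Iu; move/forallP/(_ a)/forall_inP/(_ u Iu): IM.
- by apply/forall_inP=> u Iu; apply/forall_inP=> v Iv; apply: ID.
- by apply/forallP=> a; apply/forall_inP=> u Iu; apply: IM.
Qed.

Lemma jacobson_closed : idealr_closed jacobson.
Proof.
split.
- apply/bigcapP=> M /maxsetp/andP[/left_idealP[M0 _ _] _]; exact: M0.
- have P0 : proper_left_ideal [set 0].
    apply/andP; split.
      apply/left_idealP; split=> [|u v|a u]; rewrite !inE //.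
        by move=> /eqP-> /eqP->; rewrite addr0.
      by move=> /eqP->; rewrite mulr0.
    by apply/eqP=> /setP/(_ 1); rewrite !inE oner_eq0.
  have [M maxM _] := maxset_exists P0.
  apply/negP=> /bigcapP/(_ M maxM) M1.
  have /andP[/left_idealP[_ _ MM] /eqP[]] := maxsetp maxM.
  by apply/setP=> u; rewrite inE -[u]mulr1 MM.
- move=> a u v /bigcapP Ju /bigcapP Jv; apply/bigcapP=> M maxM.
  have /andP[/left_idealP[_ MD MM] _] := maxsetp maxM.
  by rewrite MD ?MM ?Ju ?Jv.
Qed.

HB.instance Definition _ := isIdealr.Build S jacobson jacobson_closed.

End Jacobson.

Arguments jacobson S : clear implicits.
Arguments local_ring S : clear implicits.

Definition residue_ring (R : finComNzRingType) :=
  {ideal_quot (jacobson R : idealr R)}.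

HB.instance Definition _ (R : finComNzRingType) :=
  EqQuotient.on (residue_ring R).
HB.instance Definition _ (R : finComNzRingType) :=
  GRing.ComNzRing.on (residue_ring R).
HB.instance Definition _ (R : finComNzRingType) :=
  [Countable of residue_ring R by <:%/].
HB.instance Definition _ (R : finComNzRingType) : isFinite (residue_ring R) :=
  CanIsFinite (@reprK R (residue_ring R)).
HB.instance Definition _ (R : finComNzRingType) :=
  FinRing.isNzRing.Build (residue_ring R).

Section ExceptionalUnits.
Variable S : finUnitRingType.

Definition exceptional_units : {set S} :=
  [set u | (u \is a GRing.unit) && (1 - u \is a GRing.unit)].

Definition phi (k : nat) (c : S) : nat :=
  #|[set y : k.-tuple S | all (mem exceptional_units) y
                          & \sum_(i < k) tnth y i == c]|.

End ExceptionalUnits.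

Record quaternion (R : Type) :=
  Quaternion { quat_re : R; quat_i : R; quat_j : R; quat_k : R }.

Section QuaternionEncoding.
Variable R : Type.

Definition quat_to_prod (x : quaternion R) : R * R * R * R :=
  (quat_re x, quat_i x, quat_j x, quat_k x).
Definition prod_to_quat (p : R * R * R * R) : quaternion R :=
  Quaternion p.1.1.1 p.1.1.2 p.1.2 p.2.

Lemma quat_to_prodK : cancel quat_to_prod prod_to_quat.
Proof. by case. Qed.

End QuaternionEncoding.

HB.instance Definition _ (R : eqType) :=
  Equality.copy (quaternion R) (can_type (@quat_to_prodK R)).
HB.instance Definition _ (R : choiceType) :=
  Choice.copy (quaternion R) (can_type (@quat_to_prodK R)).
HB.instance Definition _ (R : countType) :=
  Countable.copy (quaternion R) (can_type (@quat_to_prodK R)).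
HB.instance Definition _ (R : finType) :=
  Finite.copy (quaternion R) (can_type (@quat_to_prodK R)).

Section QuaternionRing.
Variable R : comNzRingType.
Implicit Types x y z : quaternion R.

Definition quat0 : quaternion R := Quaternion 0 0 0 0.
Definition quat1 : quaternion R := Quaternion 1 0 0 0.
Definition oppq x : quaternion R :=
  let: Quaternion x1 x2 x3 x4 := x in Quaternion (- x1) (- x2) (- x3) (- x4).
Definition addq x y : quaternion R :=
  let: Quaternion x1 x2 x3 x4 := x in
  let: Quaternion y1 y2 y3 y4 := y in
  Quaternion (x1 + y1) (x2 + y2) (x3 + y3) (x4 + y4).
(* The bilinear extension of i^2 = j^2 = k^2 = ijk = -1, i.e. of
   ij = k = -ji, jk = i = -kj, ki = j = -ik. *)
Definition mulq x y : quaternion R :=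
  let: Quaternion x1 x2 x3 x4 := x in
  let: Quaternion y1 y2 y3 y4 := y in
  Quaternion (x1 * y1 - x2 * y2 - x3 * y3 - x4 * y4)
             (x1 * y2 + x2 * y1 + x3 * y4 - x4 * y3)
             (x1 * y3 - x2 * y4 + x3 * y1 + x4 * y2)
             (x1 * y4 + x2 * y3 - x3 * y2 + x4 * y1).

Lemma addqA : associative addq.
Proof. by move=> [????] [????] [????] /=; rewrite !addrA. Qed.
Lemma addqC : commutative addq.
Proof. by move=> [????] [????] /=; congr Quaternion; rewrite addrC. Qed.
Lemma add0q : left_id quat0 addq.
Proof. by move=> [????] /=; rewrite !add0r. Qed.
Lemma addNq : left_inverse quat0 oppq addq.
Proof. by move=> [????] /=; rewrite !addNr. Qed.

HB.instance Definition _ :=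
  GRing.isZmodule.Build (quaternion R) addqA addqC add0q addNq.

Lemma mulqA : associative mulq.
Proof. by move=> [????] [????] [????] /=; congr Quaternion; ring. Qed.
Lemma mul1q : left_id quat1 mulq.
Proof. by move=> [????] /=; congr Quaternion; ring. Qed.
Lemma mulq1 : right_id quat1 mulq.
Proof. by move=> [????] /=; congr Quaternion; ring. Qed.
Lemma mulqDl : left_distributive mulq addq.
Proof. by move=> [????] [????] [????] /=; congr Quaternion; ring. Qed.
Lemma mulqDr : right_distributive mulq addq.
Proof. by move=> [????] [????] [????] /=; congr Quaternion; ring. Qed.
Lemma quat1_neq0 : quat1 != 0.
Proof. by apply/eqP=> -[/eqP]; rewrite oner_eq0. Qed.

HB.instance Definition _ := GRing.Zmodule_isNzRing.Build (quaternion R)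
  mulqA mul1q mulq1 mulqDl mulqDr quat1_neq0.

Definition quatC (a : R) : quaternion R := Quaternion a 0 0 0.
Definition qI : quaternion R := Quaternion 0 1 0 0.
Definition qJ : quaternion R := Quaternion 0 0 1 0.
Definition qK : quaternion R := Quaternion 0 0 0 1.

Lemma quatE (x1 x2 x3 x4 : R) :
  Quaternion x1 x2 x3 x4
  = quatC x1 + quatC x2 * qI + quatC x3 * qJ + quatC x4 * qK.
Proof. by congr Quaternion => /=; ring. Qed.

Lemma quat_relations :
  [/\ qI * qI = -1, qJ * qJ = -1, qK * qK = -1, qI * qJ * qK = -1
    & qI * qJ = - (qJ * qI)].
Proof. by split; congr Quaternion => /=; ring. Qed.

Lemma quatC_comm (a : R) :
  [/\ quatC a * qI = qI * quatC a, quatC a * qJ = qJ * quatC a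
    & quatC a * qK = qK * quatC a].
Proof. by split; congr Quaternion => /=; ring. Qed.

Lemma quatC_is_zmod_morphism : zmod_morphism quatC.
Proof. by move=> a b; congr Quaternion => /=; ring. Qed.
Lemma quatC_is_monoid_morphism : monoid_morphism quatC.
Proof. by split=> // a b; congr Quaternion => /=; ring. Qed.

HB.instance Definition _ :=
  GRing.isZmodMorphism.Build R (quaternion R) quatC quatC_is_zmod_morphism.
HB.instance Definition _ :=
  GRing.isMonoidMorphism.Build R (quaternion R) quatC quatC_is_monoid_morphism.

End QuaternionRing.

HB.instance Definition _ (R : finComNzRingType) :=
  FinRing.isNzRing.Build (quaternion R).

(* Main.v *)
From HB Require Import structures.
Require Import Defs.
From mathcomp Require Import all_boot all_order all_algebra.
From mathcomp Require Import ring zify.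

Import GRing.Theory.
Local Open Scope ring_scope.
Local Open Scope quotient_scope.

(** Let F = R/J(R), of characteristic 2. Modulo 2 the quaternion ring is the
    group algebra of the Klein four-group, so q = x1 + x2 i + x3 j + x4 k is
    sent to the class of x1 + x2 + x3 + x4 in F by a ring homomorphism. The norm
    of q has for class the square of that value, hence q is a unit iff its image
    is nonzero, and q is exceptional iff its image is neither 0 nor 1. As {0, 1}
    is a subgroup of F, the exceptional units are the complement of an additive
    subgroup A of H(R), and the number of k-tuples of elements of S \ A with a
    given sum, for any subgroup A of a finite abelian group S, satisfies a
    recurrence in k that depends only on |S|, |A| and whether the sum is in A. *)

Set Implicit Arguments.
Unset Strict Implicit.
Unset Printing Implicit Defensive.

(** * Counting tuples with entries outside a subgroup *)

Definition sum_tuples (S : finZmodType) (k : nat) (B : {set S}) (c : S) :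
    {set k.-tuple S} :=
  [set y : k.-tuple S | all (mem B) y & \sum_(i < k) tnth y i == c].

Lemma card_sum_tuples0 (S : finZmodType) (B : {set S}) (c : S) :
  #|sum_tuples 0 B c| = (c == 0).
Proof.
have [->|c0] := eqVneq c 0.
  rewrite (_ : sum_tuples 0 B 0 = [set [tuple]]) ?cards1 //.
  by apply/setP=> y; rewrite tuple0 !inE /= big_ord0 !eqxx.
apply/eqP; rewrite cards_eq0; apply/eqP/setP=> y.
by rewrite !inE big_ord0 eq_sym (negPf c0) andbF.
Qed.

Lemma card_sum_tuplesS (S : finZmodType) (k : nat) (B : {set S}) (c : S) :
  #|sum_tuples k.+1 B c| = (\sum_(b in B) #|sum_tuples k B (c - b)%R|)%N.
Proof.
have sum_cons b (y : k.-tuple S) :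
    \sum_i tnth [tuple of b :: y] i = b + \sum_i tnth y i.
  by rewrite big_ord_recl tnth0; under eq_bigr do rewrite tnthS.
rewrite -sum1_card (partition_big (@thead k S) (mem B)) => [|y]; last first.
  by case/tupleP: y => b y; rewrite !inE theadE /= => /andP[/andP[]].
apply: eq_bigr => b Bb; rewrite sum1_card.
have cons_inj : injective (fun y : k.-tuple S => [tuple of b :: y]).
  by move=> y z /(congr1 val)[] /val_inj.
rewrite -(card_imset _ cons_inj); apply: eq_card => y.
apply/andP/imsetP => [[]|[z]]; rewrite inE.
  case/tupleP: y => b' y; rewrite theadE sum_cons /= => yP /eqP b'E.
  exists y; last by rewrite b'E.
  move: yP; rewrite inE b'E => /andP[/andP[_ ->] /eqP <-] /=.
  by rewrite addrC addKr.
move=> /andP[zB /eqP zE] ->; rewrite inE theadE sum_cons /= zB zE.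
by rewrite [b \in _]Bb addrC subrK !eqxx.
Qed.

(** Induction on the length, splitting off the first entry. It starts at length 1, since for empty
    tuples the count depends on whether [c] is 0 and not only on whether [c] is in [A]. The factor
    [#|S|] avoids division. *)
Lemma card_sum_tuplesC (S : finZmodType) (A : {set S}) (k : nat) (c : S) :
    zmod_closed A ->
  #|S|%:Z * #|sum_tuples k.+1 (~: A) c|%:Z =
  (#|S|%:Z - #|A|%:Z) ^+ k.+1
  - (- #|A|%:Z) ^+ k * (#|S|%:Z * (c \in A)%:Z - #|A|%:Z).
Proof.
move=> A_zmod; have [A0 AB] := A_zmod.
have AN u : (- u \in A) = (u \in A).
  by apply/idP/idP => Au; [rewrite -[u]opprK|]; rewrite -[- _]sub0r AB.
have AD u v : u \in A -> (u + v \in A) = (v \in A).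
  move=> Au; apply/idP/idP => Av; first by rewrite -[v](addKr u) addrC AB.
  by rewrite -[u]opprK addrC AB ?AN.
have cardC : #|~: A|%:Z = #|S|%:Z - #|A|%:Z by rewrite -(cardsC A) PoszD; ring.
(* The elements [b] with [d - b] in [A] form the coset [d + A], which is [A] itself or disjoint from
   [A]. *)
have cardB d : #|[set b in ~: A | d - b \in A]|%:Z = #|A|%:Z * (d \notin A)%:Z.
  have [Ad|Ad] := boolP (d \in A).
    rewrite mulr0 (_ : [set _ in _ | _] = set0) ?cards0 //.
    apply/setP=> b; rewrite !inE AD // AN.
    by case: (b \in A).
  rewrite mulr1; congr Posz; rewrite -(card_imset A (can_inj (subKr d))).
  apply: eq_card => b; rewrite inE in_setC; apply/andP/imsetP => [[_ Adb]|[a Aa ->]].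
    by exists (d - b) => //; rewrite subKr.
  by rewrite subKr -(AD _ _ Aa) addrC subrK Ad.
elim: k c => [|k IHk] c.
  rewrite card_sum_tuplesS.
  under eq_bigr do rewrite card_sum_tuples0 subr_eq0.
  have -> : (\sum_(b in ~: A) (c == b))%N = (c \notin A).
    rewrite big_mkcond (bigD1 c) //= big1 => [|b /negPf bc]; last first.
      by rewrite eq_sym bc; case: ifP.
    by rewrite inE eqxx addn0; case: (c \in A).
  rewrite expr1 expr0; case: (c \in A) => /=; ring.
rewrite card_sum_tuplesS (big_morph Posz PoszD (erefl _)) mulr_sumr.
under eq_bigr do rewrite IHk.
have sum_constC (x : int) : \sum_(b in ~: A) x = x * (#|S|%:Z - #|A|%:Z).
  by rewrite sumr_const -mulr_natr natz cardC.
rewrite sumrB sum_constC -mulr_sumr sumrB sum_constC -mulr_sumr.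
have -> : \sum_(i in ~: A) (c - i \in A)%:Z = #|A|%:Z * (c \notin A)%:Z.
  rewrite -cardB -sum1_card (big_morph Posz PoszD (erefl _)).
  rewrite big_mkcond [RHS]big_mkcond.
  by apply: eq_bigr => b _; rewrite !inE; case: (b \in A); case: (c - b \in A).
rewrite !exprS.
case: (c \in A) => /=; ring.
Qed.

(** * Fibers, characteristic and Jacobson radical in the finite case *)

(** All fibers are translates of one another, and they partition [S]. *)
Lemma card_fiber (S F : finZmodType) (p : {additive S -> F}) (a : F) :
  (forall b, exists x, p x = b) -> (#|[set x | p x == a]| * #|F| = #|S|)%N.
Proof.
move=> p_surj.
have fiberE b : #|[set x | p x == b]| = #|[set x | p x == a]|.
  have [x px] := p_surj (b - a).
  rewrite -(card_imset [set y | p y == a] (addrI x)); apply: eq_card => y.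
  rewrite inE; apply/eqP/imsetP => [py|[z]]; rewrite ?inE.
    exists (y - x); last by rewrite addrC subrK.
    by rewrite inE raddfB px py subKr.
  by move=> /eqP pz ->; rewrite raddfD px pz subrK.
rewrite mulnC -sum_nat_const -[RHS]sum1_card (partition_big p predT) //=.
apply: eq_bigr => b _; rewrite -(fiberE b) -sum1_card.
by apply: eq_bigl => x; rewrite inE.
Qed.

(** Translation by 1 permutes [F], so it leaves the sum of all elements unchanged. *)
Lemma natr_card_finRing (F : finNzRingType) : #|F|%:R = 0 :> F.
Proof.
have : \sum_(x : F) (x + 1) = \sum_(x : F) x.
  by rewrite [RHS](reindex_inj (addIr 1)).
by rewrite big_split sumr_const /= => /(canRL (addKr _)) ->; rewrite addNr.
Qed.

(** Otherwise the left ideal generated by [1 - u] is proper and lies in a maximal one, which also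
    contains [u], hence 1. *)
Lemma jacobson_left_inverse (S : finNzRingType) (u : S) :
  u \in jacobson S -> exists v, v * (1 - u) = 1.
Proof.
move=> Ju; set I := [set v * (1 - u) | v : S].
have I_ideal : left_ideal I.
  apply/left_idealP; split.
  - by apply/imsetP; exists 0; rewrite ?mul0r.
  - move=> _ _ /imsetP[v _ ->] /imsetP[w _ ->].
    by apply/imsetP; exists (v + w); rewrite ?mulrDl.
  - move=> a _ /imsetP[v _ ->].
    by apply/imsetP; exists (a * v); rewrite ?mulrA.
have [/eqP IT|I_proper] := boolP (I == [set: S]).
  have : 1 \in I by rewrite IT inE.
  by case/imsetP=> v _ vE; exists v.
have properI : proper_left_ideal I by rewrite /proper_left_ideal I_ideal.
have [M maxM IM] := maxset_exists properI.
have /andP[/left_idealP[_ MD MM] /eqP[]] := maxsetp maxM.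
apply/setP=> v; rewrite inE -[v]mulr1 MM // -(subrK u 1) MD //.
  by apply/(subsetP IM)/imsetP; exists 1; rewrite ?mul1r.
exact: (bigcapP Ju M maxM).
Qed.

Lemma card_quaternion (T : finType) : #|{: quaternion T}| = (#|T| ^ 4)%N.
Proof.
rewrite (bij_eq_card (f := @quat_to_prod T)); last first.
  by exists (@prod_to_quat T); [exact: quat_to_prodK | case=> [[[]]]].
by rewrite !card_prod !expnS muln1 !mulnA.
Qed.

(* The finite unit ring structure on [quaternion R] does not by itself let Rocq
   infer a [finZmodType]. *)
HB.instance Definition _ (R : finComNzRingType) :=
  FinRing.Zmodule.copy (quaternion R) (quaternion R : finUnitRingType).

(** * The augmentation from the quaternion ring to the residue field *)

Section QuaternionAugmentation.
Variable R : finComNzRingType.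
Local Notation F := (residue_ring R).

Definition residue (x : R) : F := \pi_(residue_ring R) x.

Let pi_jacobson : {rmorphism R -> {ideal_quot (jacobson R : idealr R)}} :=
  \pi_({ideal_quot (jacobson R : idealr R)}).

Lemma residue_is_zmod_morphism : zmod_morphism residue.
Proof. exact: (rmorphB pi_jacobson). Qed.

Lemma residue_is_monoid_morphism : monoid_morphism residue.
Proof. by split; [exact: (rmorph1 pi_jacobson) | exact: (rmorphM pi_jacobson)]. Qed.

HB.instance Definition _ :=
  GRing.isZmodMorphism.Build R F residue residue_is_zmod_morphism.
HB.instance Definition _ :=
  GRing.isMonoidMorphism.Build R F residue residue_is_monoid_morphism.

Lemma residue_eq (x y : R) : (residue x == residue y) = (x - y \in jacobson R).
Proof. by rewrite Quotient.idealrBE. Qed.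

Definition augmentation (q : quaternion R) : F :=
  residue (quat_re q + quat_i q + quat_j q + quat_k q).

Lemma augmentation_is_zmod_morphism : zmod_morphism augmentation.
Proof.
by move=> [????] [????]; rewrite /augmentation -rmorphB; congr residue => /=; ring.
Qed.

HB.instance Definition _ := GRing.isZmodMorphism.Build (quaternion R) F
  augmentation augmentation_is_zmod_morphism.

Lemma augmentation_surj (a : F) : exists q, augmentation q = a.
Proof.
exists (quatC (repr a)); rewrite /augmentation /= !addr0.
exact: reprK.
Qed.

Lemma augmentation1 : augmentation 1 = 1.
Proof. by rewrite /augmentation /= !addr0 rmorph1. Qed.

Hypothesis F2 : 2 = 0 :> F.

Lemma augmentationM (q q' : quaternion R) :
  augmentation (q * q') = augmentation q * augmentation q'.
Proof.
case: q q' => [x1 x2 x3 x4] [y1 y2 y3 y4]; rewrite /augmentation -rmorphM /=.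
set s := (X in _ = residue X).
(* [t] collects the six products that carry a minus sign in [mulq]. *)
pose t := x2 * y2 + x3 * y3 + x4 * y4 + x2 * y4 + x3 * y2 + x4 * y3.
rewrite (_ : _ + _ = s - 2 * t); last by rewrite /s /t; ring.
by rewrite rmorphB [X in _ - X]rmorphM rmorph_nat F2 mul0r subr0.
Qed.

Hypothesis F_field : GRing.field_axiom F.

(** A lift [repr z] of the inverse of the class of [x] makes [repr z * x] differ from 1 by an
    element of the radical, so this product is left invertible. *)
Lemma residue_inv (x : R) : residue x != 0 -> exists y, y * x = 1.
Proof.
move=> /F_field/unitrP[z [zx _]].
have /jacobson_left_inverse[v] : 1 - repr z * x \in jacobson R.
  rewrite -residue_eq rmorph1 rmorphM /= eq_sym.
  by apply/eqP; rewrite -{}zx; congr (_ * _); apply: reprK.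
by rewrite subKr mulrA; exists (v * repr z).
Qed.

Lemma quaternion_unit (q : quaternion R) :
  (q \is a GRing.unit) = (augmentation q != 0).
Proof.
apply/idP/idP => [/mulrV qV|].
  apply/eqP=> q0; case/eqP: (oner_neq0 F).
  by rewrite -augmentation1 -qV augmentationM q0 mul0r.
case: q => x1 x2 x3 x4; rewrite /augmentation /= => s0.
set s := _ + _ in s0; pose N := x1 * x1 + x2 * x2 + x3 * x3 + x4 * x4.
have [|y yN] := @residue_inv N.
  pose t := x1 * x2 + x1 * x3 + x1 * x4 + x2 * x3 + x2 * x4 + x3 * x4.
  rewrite (_ : N = s * s - 2 * t); last by rewrite /N /s /t; ring.
  rewrite rmorphB [X in _ - X]rmorphM rmorph_nat F2 mul0r subr0 rmorphM.
  apply: contraNneq (s0) => ss0.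
  by rewrite -[residue s](mulKr (F_field s0)) ss0 mulr0.
(* The inverse is the conjugate quaternion divided by its norm [N]. *)
apply/unitrP; exists (Quaternion (y * x1) (- y * x2) (- y * x3) (- y * x4)).
have -> : 1 = Quaternion (y * N) 0 0 0 by rewrite yN.
by split; congr Quaternion => /=; rewrite /N; ring.
Qed.

Definition augmentation01 : {set quaternion R} :=
  [set q | augmentation q \in [:: 0; 1]].

Lemma exceptional_units_quaternion :
  exceptional_units (quaternion R) = ~: augmentation01.
Proof.
apply/setP=> q; rewrite !inE !quaternion_unit raddfB /= augmentation1 subr_eq0.
by rewrite negb_or [1 == _]eq_sym.
Qed.

(** In characteristic 2, -1 = 1, so {0, 1} is closed under subtraction; the set is its preimage. *)
Lemma augmentation01_zmod : zmod_closed augmentation01.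
Proof.
have N1 : -1 = 1 :> F by apply/eqP; rewrite -subr_eq0 -opprD oppr_eq0 -mulr2n F2.
split=> [|q q']; rewrite !inE ?raddf0 ?eqxx // raddfB /=.
by case/orP=> /eqP-> /orP[]/eqP->; rewrite ?subrr ?subr0 ?sub0r ?N1 eqxx ?orbT.
Qed.

Lemma card_augmentation01 : (#|augmentation01| * #|{: F}| = 2 * #|R| ^ 4)%N.
Proof.
have -> : augmentation01 =
    [set q | augmentation q == 0] :|: [set q | augmentation q == 1].
  by apply/setP=> q; rewrite !inE.
rewrite cardsU (_ : _ :&: _ = set0) ?cards0 ?subn0; last first.
  apply/setP=> q; rewrite !inE; apply/negP => /andP[/eqP->].
  by rewrite eq_sym oner_eq0.
by rewrite mulnDl !(card_fiber _ augmentation_surj) card_quaternion addnn mul2n.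
Qed.

End QuaternionAugmentation.

Theorem theorem3p4 (k n r : nat) (R : finComNzRingType)
    (hk : (2 <= k)%N)
    (hlocal : local_ring R)
    (hcard : #|R| = (2 ^ (n * r))%N)
    (hfield : GRing.field_axiom (residue_ring R))
    (hres : #|{: residue_ring R}| = (2 ^ r)%N)
    (x1 x2 x3 x4 : R) :
  (phi k (Quaternion x1 x2 x3 x4))%:Z =
  if \pi_(residue_ring R) (x1 + x2 + x3 + x4) \in [:: 0; 1]
  then (-1) ^+ k * 2 ^+ ((4 * n * k - 4 * n - k) * r)
       * (2 ^+ (r + k - 1) - 2 ^+ k + (2 - 2 ^+ r) ^+ k)
  else (-1) ^+ k * 2 ^+ ((4 * n * k - 4 * n - k) * r)
       * (- 2 ^+ k + (2 - 2 ^+ r) ^+ k).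
Proof.
set c := Quaternion x1 x2 x3 x4.
have r_gt0 : (0 < r)%N.
  rewrite lt0n; apply: contraTneq (card_finNzRing_gt1 (residue_ring R)) => r0.
  by rewrite hres r0.
have n_gt0 : (0 < n)%N.
  rewrite lt0n; apply: contraTneq (card_finNzRing_gt1 R) => n0.
  by rewrite hcard n0.
(* The cardinal [2 ^ r] vanishes in the residue field; if 2 were nonzero there, its powers would be
   units. *)
have F2 : 2 = 0 :> residue_ring R.
  apply/eqP; apply: contraPT (natr_card_finRing (residue_ring R)) => two_neq0.
  rewrite hres natrX; apply/eqP.
  have : (2 : residue_ring R) ^+ r \is a GRing.unit by rewrite unitrX ?hfield.
  by apply: contraTneq => ->; rewrite unitr0.
have -> : (\pi_(residue_ring R) (x1 + x2 + x3 + x4) \in [:: 0; 1]) =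
    (c \in augmentation01 R) by rewrite [RHS]inE.
set A := augmentation01 R.
have phiE : phi k c = #|sum_tuples k (~: A) c|.
  by rewrite /A -exceptional_units_quaternion.
rewrite phiE; case: k hk {phiE} => // m m_gt0.
(* M is the size of a fiber of the augmentation. *)
pose M : int := 2 ^+ ((4 * n - 1) * r).
have cardS : #|{: quaternion R}|%:Z = 2 ^+ r * M.
  rewrite card_quaternion hcard -expnM -natz natrX /M -exprD; congr (_ ^+ _).
  nia.
have cardA : #|A|%:Z = 2 * M.
  have := card_augmentation01 R; rewrite hres -card_quaternion => /(congr1 Posz).
  rewrite !PoszM cardS -[(2 ^ r)%:Z]natz natrX => AE.
  by apply: (mulIf (expf_neq0 r (_ : 2 != 0))) => //; rewrite AE; ring.
have := card_sum_tuplesC m c (augmentation01_zmod F2).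
rewrite cardS cardA; set N := Posz _; set E := ((_ - _) * r)%N => NE.
(* The truncated subtractions in [E] are genuine because [n] is at least 1 and the tuple length at
   least 2. The factor [2 ^+ r * M] is the size of the quaternion ring, to be cancelled. *)
have ME : M ^+ m.+1 = 2 ^+ r * M * 2 ^+ E.
  rewrite /M -exprM -!exprD; congr (_ ^+ _); rewrite /E; nia.
have qM0 : 2 ^+ r * M != 0 by rewrite mulf_neq0 ?expf_neq0.
apply: (mulfI qM0); rewrite {}NE.
have -> : (r + m.+1 - 1 = r + m)%N by lia.
have -> : (2 ^+ r * M - 2 * M) ^+ m.+1 =
    M ^+ m.+1 * ((-1) ^+ m.+1 * (2 - 2 ^+ r) ^+ m.+1).
  by rewrite -!exprMn; congr (_ ^+ _); ring.
have -> : (- (2 * M)) ^+ m = (-1) ^+ m * 2 ^+ m * M ^+ m.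
  by rewrite -!exprMn; congr (_ ^+ _); ring.
(* Both cases of the formula at once: they differ only by the term that the indicator of [c \in A]
   multiplies. *)
transitivity (M ^+ m.+1 * (-1) ^+ m.+1 *
    (2 ^+ r * 2 ^+ m * (c \in A)%:Z - 2 ^+ m.+1 + (2 - 2 ^+ r) ^+ m.+1)).
  by rewrite !exprS; ring.
rewrite ME; case: (c \in A); rewrite ?exprD /=; ring.
Qed.
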